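(* Let $R$ be a field of characteristic different from $2$ and let $k\ge1$ be an integer with $k\equiv 2$ or $k\equiv 3 \pmod 4$. Then there is no near-group category over $R$ with fusion rule $(G,k)$ where $G$ is the trivial group; that is, there is no semisimple rigid monoidal $R$-linear category whose simple objects are (up to isomorphism) exactly the unit $\epsilon$ and one further object $m$ with $m\otimes m\cong \epsilon\oplus k\cdot m$.
   Context: A near-group category with fusion rule $(\{\epsilon\},k)$ over $R$: an $R$-linear category with finite-dimensional hom-spaces, exactly two isomorphism classes of simple objects $\epsilon,m$ with $\mathrm{hom}(s,s)\cong R$ for a simple $s$ and $\mathrm{hom}(\epsilon,m)=0$, every object a finite direct sum of simples; a bilinear tensor product with unit object $\epsilon$ and natural associativity isomorphisms satisfying the pentagon axiom; duality: every object $x$ has a dual $x^*$ with evaluation $x^*\otimes x\to\epsilon$ and coevaluation $\epsilon\to x\otimes x^*$ satisfying the zig-zag identities; and the fusion rule $m\otimes m\cong\epsilon\oplus k\cdot m$. *)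

(* Defs.v *)
From HB Require Import structures.
From mathcomp Require Import all_boot all_order all_algebra.
Set Implicit Arguments. Unset Strict Implicit. Unset Printing Implicit Defensive.
Import GRing.Theory.
Local Open Scope ring_scope.

Record rigid_monoidal_cat (R : fieldType) := RigidMonoidalCat {
  Obj : Type;
  Hom : Obj -> Obj -> vectType R;
  comp : forall {a b c : Obj}, Hom b c -> Hom a b -> Hom a c;
  idm : forall a : Obj, Hom a a;
  comp_linl : forall a b c (g : Hom a b) (r : R) (f1 f2 : Hom b c),
      comp (r *: f1 + f2) g = r *: comp f1 g + comp f2 g;
  comp_linr : forall a b c (f : Hom b c) (r : R) (g1 g2 : Hom a b),
      comp f (r *: g1 + g2) = r *: comp f g1 + comp f g2;
  compA : forall a b c d (f : Hom c d) (g : Hom b c) (h : Hom a b),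
      comp f (comp g h) = comp (comp f g) h;
  comp1m : forall a b (f : Hom a b), comp (idm b) f = f;
  compm1 : forall a b (f : Hom a b), comp f (idm a) = f;
  tens : Obj -> Obj -> Obj;
  tensm : forall {a b c d : Obj}, Hom a b -> Hom c d -> Hom (tens a c) (tens b d);
  tensm_linl : forall a b c d (g : Hom c d) (r : R) (f1 f2 : Hom a b),
      tensm (r *: f1 + f2) g = r *: tensm f1 g + tensm f2 g;
  tensm_linr : forall a b c d (f : Hom a b) (r : R) (g1 g2 : Hom c d),
      tensm f (r *: g1 + g2) = r *: tensm f g1 + tensm f g2;
  tensm_comp : forall a1 b1 c1 a2 b2 c2 (f1 : Hom b1 c1) (g1 : Hom a1 b1)
      (f2 : Hom b2 c2) (g2 : Hom a2 b2),
      tensm (comp f1 g1) (comp f2 g2) = comp (tensm f1 f2) (tensm g1 g2);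
  tensm_id : forall a b, tensm (idm a) (idm b) = idm (tens a b);
  unit : Obj;
  asc : forall a b c, Hom (tens (tens a b) c) (tens a (tens b c));
  asci : forall a b c, Hom (tens a (tens b c)) (tens (tens a b) c);
  asc_iso1 : forall a b c, comp (asci a b c) (asc a b c) = idm _;
  asc_iso2 : forall a b c, comp (asc a b c) (asci a b c) = idm _;
  asc_nat : forall a a' b b' c c' (f : Hom a a') (g : Hom b b') (h : Hom c c'),
      comp (asc a' b' c') (tensm (tensm f g) h)
      = comp (tensm f (tensm g h)) (asc a b c);
  lu : forall a, Hom (tens unit a) a;
  lui : forall a, Hom a (tens unit a);
  lu_iso1 : forall a, comp (lui a) (lu a) = idm _;
  lu_iso2 : forall a, comp (lu a) (lui a) = idm _;
  lu_nat : forall a b (f : Hom a b), comp (lu b) (tensm (idm unit) f) = comp f (lu a);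
  ru : forall a, Hom (tens a unit) a;
  rui : forall a, Hom a (tens a unit);
  ru_iso1 : forall a, comp (rui a) (ru a) = idm _;
  ru_iso2 : forall a, comp (ru a) (rui a) = idm _;
  ru_nat : forall a b (f : Hom a b), comp (ru b) (tensm f (idm unit)) = comp f (ru a);
  pentagon : forall a b c d,
      comp (asc a b (tens c d)) (asc (tens a b) c d)
      = comp (tensm (idm a) (asc b c d))
             (comp (asc a (tens b c) d) (tensm (asc a b c) (idm d)));
  triangle : forall a b,
      comp (tensm (idm a) (lu b)) (asc a unit b) = tensm (ru a) (idm b);
  dual : Obj -> Obj;
  ev : forall a, Hom (tens (dual a) a) unit;
  coev : forall a, Hom unit (tens a (dual a));
  zigzag1 : forall a,
      comp (ru a) (comp (tensm (idm a) (ev a))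
        (comp (asc a (dual a) a) (comp (tensm (coev a) (idm a)) (lui a))))
      = idm a;
  zigzag2 : forall a,
      comp (lu (dual a)) (comp (tensm (ev a) (idm (dual a)))
        (comp (asci (dual a) a (dual a))
          (comp (tensm (idm (dual a)) (coev a)) (rui (dual a)))))
      = idm (dual a)
}.

Arguments Hom {R} r0 _ _.


Section NearGroup.
Variables (R : fieldType) (C : rigid_monoidal_cat R).

Definition is_iso (a b : Obj C) (f : Hom C a b) :=
  exists g : Hom C b a, comp g f = idm a /\ comp f g = idm b.

Definition isomorphic (a b : Obj C) := exists f : Hom C a b, is_iso f.

Definition is_biproduct (n : nat) (s : 'I_n -> Obj C) (x : Obj C) :=
  exists (inj : forall i, Hom C (s i) x) (prj : forall i, Hom C x (s i)),
    [/\ (forall i, comp (prj i) (inj i) = idm (s i)),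
        (forall i j, i != j -> comp (prj i) (inj j) = 0)
      & \sum_(i < n) comp (inj i) (prj i) = idm x].

Definition hom_dim (a b : Obj C) : nat := \dim (fullv : {vspace Hom C a b}).

Definition near_group_trivial (k : nat) :=
  exists m : Obj C,
    [/\ hom_dim (unit C) (unit C) = 1%N,
        hom_dim m m = 1%N,
        hom_dim (unit C) m = 0%N,
        (forall x : Obj C, exists n (s : 'I_n -> Obj C),
            (forall i, isomorphic (s i) (unit C) \/ isomorphic (s i) m)
            /\ is_biproduct s x)
      & exists x : Obj C,
          is_biproduct (fun i : 'I_k.+1 => if i == ord0 then unit C else m) x
          /\ isomorphic (tens m m) x].

End NearGroup.

(* Main.v *)
Require Import Defs.
From HB Require Import structures.
From mathcomp Require Import all_boot all_order all_algebra.
From mathcomp Require Import all_fingroup zify ring.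
Import Defs.
Set Implicit Arguments. Unset Strict Implicit. Unset Printing Implicit Defensive.
Import GRing.Theory.
Local Open Scope ring_scope.

(** Choose projections [b : m (x) m -> 1] and [psi_i : m (x) m -> m].  The
    associator of [(m, m, m)] is then a matrix [A] of size [k] on morphisms to
    [1] and a matrix [B] of size [k^2 + 1] on morphisms to [m].  The two sides
    of the pentagon on [(m, m, m, m)] agree only after the tensor factors of
    [m (x) m -> m] coming from the two halves of [(m m)(m m)] are exchanged, and
    the determinant sees the sign of this permutation.  With [alpha = det A],
    [beta = det B] and [k(k-1)/2] odd, the pentagons to [1] and to [m] give
    [beta^2 = - alpha^k] and [beta^k alpha^2 = 1].  Rigidity makes the
    [(1, 1)]-entry of [B] nonzero, and then two entries of the second pentagon
    force [alpha^3 = 1].  So [beta^3] has square [-1] and [k]-th power [1],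
    which is impossible unless [4] divides [k]. *)

(** * Determinants indexed by finite types *)

Section FiniteDeterminant.
Variable R : fieldType.

Definition fdet (T : finType) (F : T -> T -> R) : R :=
  \det (\matrix_(i < #|T|, j < #|T|) F (enum_val i) (enum_val j)).

Definition fmul (T : finType) (F G : T -> T -> R) x z := \sum_y F x y * G y z.

Lemma eq_fdet (T : finType) (F G : T -> T -> R) : F =2 G -> fdet F = fdet G.
Proof. by move=> FG; congr (\det _); apply/matrixP=> i j; rewrite !mxE FG. Qed.

Lemma fdet_mul (T : finType) (F G : T -> T -> R) :
  fdet (fmul F G) = fdet F * fdet G.
Proof.
rewrite -det_mulmx; congr (\det _); apply/matrixP=> i j; rewrite !mxE.
by rewrite /fmul (reindex (@enum_val T predT)) /=; [apply: eq_bigr => l _; rewrite !mxE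
  | apply: onW_bij; apply: enum_val_bij].
Qed.

(** Enumerating by [h] instead of [enum_val] permutes rows and columns by the same permutation, so
    the two signs cancel. Hence [fdet] can be computed along any convenient enumeration. *)
Lemma fdet_ord (T : finType) n (h : 'I_n -> T) (F : T -> T -> R) :
  bijective h -> \det (\matrix_(i < n, j < n) F (h i) (h j)) = fdet F.
Proof.
move=> hb; have En : n = #|T| by rewrite -(bij_eq_card hb) card_ord.
subst n; have inj_s : injective (enum_rank \o h).
  exact: inj_comp (@enum_rank_inj T) (bij_inj hb).
rewrite /fdet; set M := (X in _ = \det X).
have -> : \matrix_(i, j) F (h i) (h j) = row_perm (perm inj_s) (col_perm (perm inj_s) M).
  by apply/matrixP=> i j; rewrite !mxE !permE /= !enum_rankK.
rewrite row_permE col_permE !det_mulmx !det_perm mulrCA -signr_addb.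
by rewrite odd_permV addbb mulr1.
Qed.

Lemma fdet_bij (S T : finType) (h : S -> T) (F : T -> T -> R) :
  bijective h -> fdet (fun x y => F (h x) (h y)) = fdet F.
Proof.
move=> hb; apply: (fdet_ord (h := h \o enum_val)).
exact: bij_comp hb (@enum_val_bij S).
Qed.

Lemma fdet_tperm (T : finType) (a b : T) (F : T -> T -> R) :
  a != b -> fdet (fun x y => F (tperm a b x) y) = - fdet F.
Proof.
move=> ab; rewrite /fdet; set M := (X in _ = - \det X).
have -> : \matrix_(i, j) F (tperm a b (enum_val i)) (enum_val j)
    = row_perm (tperm (enum_rank a) (enum_rank b)) M.
  apply/matrixP=> i j; rewrite !mxE; congr (F _ _).
  by rewrite (inj_tperm _ _ _ (@enum_val_inj _ _)) !enum_rankK.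
by rewrite row_permE det_mulmx det_perm odd_tperm (inj_eq enum_rank_inj) ab mulN1r.
Qed.

(** The involution is a product of [N] disjoint transpositions of rows; the induction on [N] splits
    one off. *)
Lemma fdet_involution (T : finType) (s : T -> T) (F : T -> T -> R) N :
  involutive s -> #|T| = (#|[pred x | s x == x]| + N.*2)%N ->
  fdet (fun x y => F (s x) y) = (-1) ^+ N * fdet F.
Proof.
move=> ss; rewrite -(cardC [pred x | s x == x]) => /addnI card_s.
have {card_s} : #|[pred x | s x != x]| = N.*2 by rewrite -card_s; apply: eq_card.
move: ss; elim: N s F => [|N IHN] s F ss card_s.
  rewrite mul1r; apply: eq_fdet => x y; congr (F _ _); apply/eqP/negbFE.
  exact: (card0_eq card_s x).
have /card_gt0P[a] : (0 < #|[pred x | s x != x]|)%N by rewrite card_s.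
(* [t] agrees with [s] except that it fixes [a] and [s a], so it has one 2-cycle fewer. *)
rewrite inE => sa; pose t x := tperm a (s a) (s x).
have tE x : t x = if (x == a) || (x == s a) then x else s x.
  have sa_x : (x == s a) = (s x == a) by rewrite -(inj_eq (can_inj ss)) ss.
  rewrite /t -(inj_eq (can_inj ss) x a) sa_x; case: tpermP => [sxa|/(can_inj ss)->|].
  - by rewrite sxa eqxx orbT -sxa ss.
  - by rewrite eqxx.
  by do 2!move=> /eqP/negPf->.
have tt : involutive t.
  move=> x; rewrite (tE x); case: ifP => xa; first by rewrite tE xa.
  rewrite tE -(inj_eq (can_inj ss)) ss.
  by rewrite (inj_eq (can_inj ss)) orbC xa.
transitivity (fdet (fun x y => F (tperm a (s a) (t x)) y)).
  by apply: eq_fdet => x y; rewrite /t tpermK.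
rewrite (IHN t (fun x y => F (tperm a (s a) x) y)) //.
  by rewrite fdet_tperm 1?eq_sym // exprS mulrN mulN1r mulNr.
move: card_s; rewrite (cardD1 a) (cardD1 (s a)) !inE sa ss eq_sym sa doubleS.
case=> <-; apply: eq_card => x; rewrite !inE tE.
have [-> | xa] := eqVneq x a; first by rewrite eqxx andbF.
by have [-> | xsa] := eqVneq x (s a); rewrite ?eqxx.
Qed.

(** Listing [S] before [T] makes the matrix block diagonal. *)
Lemma fdet_sum (S T : finType) (F : S -> S -> R) (G : T -> T -> R) :
  fdet (fun x y : S + T => match x, y with
    | inl a, inl b => F a b | inr a, inr b => G a b | _, _ => 0 end)
  = fdet F * fdet G.
Proof.
set H := fun x y => _.
pose h (i : 'I_(#|S| + #|T|)) : S + T :=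
  match split i with inl j => inl (enum_val j) | inr j => inr (enum_val j) end.
have hb : bijective h.
  exists (fun x => match x with
    | inl a => lshift _ (enum_rank a) | inr b => rshift _ (enum_rank b) end).
    by move=> i; rewrite /h; case: split_ordP => j ->; rewrite enum_valK.
  case=> a; rewrite /h; first have /= -> := unsplitK (inl (enum_rank a) : 'I_#|S| + 'I_#|T|).
    by rewrite enum_rankK.
  have /= -> := unsplitK (inr (enum_rank a) : 'I_#|S| + 'I_#|T|).
  by rewrite enum_rankK.
rewrite -(fdet_ord _ hb) /fdet -(det_ublock _ 0); congr (\det _).
apply/matrixP=> i j; rewrite !mxE /h.
by case: split_ordP => i' _; rewrite !mxE; case: split_ordP => j' _; rewrite !mxE.
Qed.

(** The matrix is the Kronecker product of an identity matrix with [G]; over ['I_n] its blocks are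
    split off one at a time. *)
Lemma fdet_pairr (S U : finType) (G : U -> U -> R) :
  fdet (fun x y : S * U => (x.1 == y.1)%:R * G x.2 y.2) = fdet G ^+ #|S|.
Proof.
have ord n : fdet (fun x y : 'I_n * U => (x.1 == y.1)%:R * G x.2 y.2) = fdet G ^+ n.
  elim: n => [|n IHn].
    rewrite /fdet; move: (\matrix_(i, j) _); rewrite card_prod card_ord mul0n => M.
    by rewrite det_mx00.
  rewrite exprS -IHn -fdet_sum.
  pose h (x : U + 'I_n * U) : 'I_n.+1 * U :=
    match x with inl u => (ord0, u) | inr p => (lift ord0 p.1, p.2) end.
  have hb : bijective h.
    exists (fun p => match unlift ord0 p.1 with None => inl p.2 | Some i => inr (i, p.2) end).
      by case=> [u|[i u]] /=; rewrite ?unlift_none ?liftK.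
    by case=> i u /=; case: unliftP => [j|] ->.
  rewrite -(fdet_bij _ hb); apply: eq_fdet => -[u|[i u]] [v|[j v]] /=.
  - by rewrite mul1r.
  - by rewrite mul0r.
  - by rewrite mul0r.
  - by rewrite (inj_eq lift_inj).
rewrite -ord -(fdet_bij (h := fun p : 'I_#|S| * U => (enum_val p.1, p.2))).
  by apply: eq_fdet => -[i u] [j v] /=; rewrite (inj_eq enum_val_inj).
exists (fun p => (enum_rank p.1, p.2)) => -[i u] /=; by rewrite ?enum_valK ?enum_rankK.
Qed.

Lemma fdet_pairl (S U : finType) (G : U -> U -> R) :
  fdet (fun x y : U * S => (x.2 == y.2)%:R * G x.1 y.1) = fdet G ^+ #|S|.
Proof.
rewrite -fdet_pairr -[RHS](fdet_bij (h := fun p : U * S => (p.2, p.1))) //.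
by exists (fun p => (p.2, p.1)); case.
Qed.

Lemma fdet_scalar (T : finType) (a : R) :
  fdet (fun x y : T => a *+ (x == y)) = a ^+ #|T|.
Proof.
rewrite -det_scalar; congr (\det _); apply/matrixP=> i j.
by rewrite !mxE (inj_eq enum_val_inj).
Qed.

Lemma fdet_one (T : finType) : fdet (fun x y : T => (x == y)%:R) = 1.
Proof. by rewrite fdet_scalar expr1n. Qed.

Lemma fdet_tr (T : finType) (F : T -> T -> R) : fdet (fun x y => F y x) = fdet F.
Proof. by rewrite /fdet -det_tr; congr (\det _); apply/matrixP=> i j; rewrite !mxE. Qed.

Lemma fdet_option (T : finType) (F : T -> T -> R) :
  fdet (fun x y => match x, y with
    | None, None => 1 | Some a, Some b => F a b | _, _ => 0 end) = fdet F.
Proof.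
rewrite -[RHS]mul1r -[1 in RHS](fdet_one Datatypes.unit) -fdet_sum.
pose h (x : option T) : Datatypes.unit + T := if x is Some a then inr a else inl tt.
rewrite -[RHS](fdet_bij (h := h)); first by apply: eq_fdet => -[a|] [b|].
by exists (fun x => if x is inr a then Some a else None); [case | case=> [[]|]].
Qed.

End FiniteDeterminant.

(** * The pentagon equations as matrix identities *)

Lemma card_fixpoints (S T : finType) (s : T -> T) (h : S -> T) :
  injective h -> (forall y, s (h y) = h y) ->
  (forall x, s x = x -> exists y, x = h y) -> #|[pred x | s x == x]| = #|S|.
Proof.
move=> h_inj sh fixE; rewrite -(card_codom h_inj); apply: eq_card => x.
rewrite !inE; apply/eqP/codomP => [/fixE //|[y ->]]; exact: sh.
Qed.

Section PentagonMatrices.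
Variables (R : fieldType) (I : finType).
Variables (A : I -> I -> R) (B : option (I * I) -> option (I * I) -> R).

(** Matrix, on morphisms to the unit, of an associator one of whose arguments is [tens m m]. The
    label [p] of that argument is carried along by naturality and [A] acts on the other label; the
    entry 1 at [None] comes from unit coherence. *)
Definition pent_unit (x y : option (I * I)) : R :=
  match x, y with
  | None, None => 1
  | Some (p, q), Some (p', q') => (p == p')%:R * A q q'
  | _, _ => 0
  end.

Definition pent_swap (x : option (I * I)) : option (I * I) :=
  if x is Some (p, q) then Some (q, p) else None.

(* Labels of the basis of [Hom(((m m) m) m, m)]: [inl (Some (p, q), r)] is
   [psi_r (psi_q (psi_p . 1) . 1)], innermost label first; [None], resp.
   [inr], means that the first two, resp. three, factors are mapped to the unit
   object.  The other bracketings are labelled in the same way. *)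
Definition tree4 : finType := (option (I * I) * I + I)%type.

(** Associator of three of the four factors. If these fuse to [m], [B] acts and the outer label is
    kept; if they fuse to the unit, [G] acts. The pentagon uses [G = A]; the parameter lets
    [pent_mid] take the identity instead. *)
Definition pent_diag (G : I -> I -> R) (x y : tree4) : R :=
  match x, y with
  | inl (a, r), inl (b, s) => (r == s)%:R * B a b
  | inr p, inr q => G p q
  | _, _ => 0
  end.

(* Moves the label that is left fixed by the associator with one factor [m m]
   into last position, where the associator becomes block diagonal. *)
Definition tree4_rot (x : tree4) : tree4 :=
  match x with
  | inl (Some (p, q), r) => inl (Some (q, r), p)
  | inl (None, r) => inr r
  | inr p => inl (None, p)
  end.

(** Exchange of the two halves of [(m m)(m m)]: the trees sending the left half to the unit
    correspond to those sending the right half there. *)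
Definition tree4_swap (x : tree4) : tree4 :=
  match x with
  | inl (Some (p, q), r) => inl (Some (q, p), r)
  | inl (None, r) => inr r
  | inr p => inl (None, p)
  end.

Definition tree4_unrot (x : tree4) : tree4 :=
  match x with
  | inl (Some (q, r), p) => inl (Some (p, q), r)
  | inl (None, p) => inr p
  | inr r => inl (None, r)
  end.

(** Associator with one argument [tens m m]. The identity block is the case where this argument is
    mapped to the unit. *)
Definition pent_mid (x y : tree4) : R :=
  pent_diag (fun p q => (p == q)%:R) (tree4_rot x) (tree4_rot y).

Lemma tree4_unrotK : cancel tree4_unrot tree4_rot.
Proof. by move=> [[[[p q]|] r]|p]. Qed.

Lemma tree4_rotK : cancel tree4_rot tree4_unrot.
Proof. by move=> [[[[p q]|] r]|p]. Qed.

Lemma tree4_rot_bij : bijective tree4_rot.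
Proof. exact: Bijective tree4_rotK tree4_unrotK. Qed.

Lemma sum_delta (V : lmodType R) (J : finType) (j : J) (h : J -> V) :
  \sum_i (j == i)%:R *: h i = h j.
Proof.
rewrite (bigD1 j) //= eqxx scale1r big1 ?addr0 // => i /negPf ij.
by rewrite eq_sym ij scale0r.
Qed.

Lemma pent_unit_sum (V : lmodType R) (h : option (I * I) -> V) x :
  \sum_y pent_unit x y *: h y =
  if x is Some (p, q) then \sum_q' A q q' *: h (Some (p, q')) else h None.
Proof.
rewrite (bigD1 None) //= (reindex_omap (Some : I * I -> _) id) /=; last by case.
case: x => [[p q]|] /=; last first.
  by rewrite scale1r big1 ?addr0 // => -[p q] _; rewrite scale0r.
rewrite scale0r add0r -[RHS](sum_delta p (fun p => \sum_q' A q q' *: h (Some (p, q')))).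
under [RHS]eq_bigr do rewrite scaler_sumr; rewrite pair_bigA.
by apply: eq_big => -[p' q']; rewrite ?eqxx //= scalerA.
Qed.

Lemma pent_diag_sum (V : lmodType R) G (h : tree4 -> V) x :
  \sum_y pent_diag G x y *: h y =
  match x with
  | inl (a, r) => \sum_b B a b *: h (inl (b, r))
  | inr p => \sum_q G p q *: h (inr q)
  end.
Proof.
rewrite big_sumType /=; case: x => [[a r]|p] /=; last first.
  rewrite big1 ?add0r // => -[b s] _; exact: scale0r.
rewrite [X in _ + X]big1 ?addr0 => [|q _]; last exact: scale0r.
transitivity (\sum_b \sum_s ((r == s)%:R * B a b) *: h (inl (b, s))).
  by rewrite pair_bigA; apply: eq_bigr => -[].
apply: eq_bigr => b _; rewrite -[RHS](sum_delta r (fun s => B a b *: h (inl (b, s)))).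
by apply: eq_bigr => s _; rewrite scalerA.
Qed.

Lemma pent_mid_sum (V : lmodType R) (h : tree4 -> V) x :
  \sum_y pent_mid (tree4_unrot x) y *: h y =
  match x with
  | inl (a, s) => \sum_b B a b *: h (tree4_unrot (inl (b, s)))
  | inr r => h (inl (None, r))
  end.
Proof.
rewrite (reindex tree4_unrot) /=; last first.
  by apply: onW_bij; exists tree4_rot; [exact: tree4_unrotK | exact: tree4_rotK].
under eq_bigr do rewrite /pent_mid !tree4_unrotK.
rewrite pent_diag_sum; case: x => [[a s]|r] //.
exact: (sum_delta r (fun r => h (inl (None, r)))).
Qed.

(** * Determinants of the two pentagon identities *)

Hypothesis pentagon_unit :
  fmul pent_unit (fun x y => pent_unit (pent_swap x) y) =2 fmul (fmul B pent_unit) B.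
Hypothesis pentagon_simple :
  fmul pent_mid (fun x y => pent_mid (tree4_swap x) y)
  =2 fmul (fmul (pent_diag A) pent_mid) (pent_diag A).

Let N := 'C(#|I|, 2).

(** Exchanging coordinates on [I * I] fixes the diagonal and has [N] two-cycles. *)
Lemma card_sqr : (#|I| * #|I| = #|I| + N.*2)%N.
Proof.
have := mul_bin_diag #|I| 1; rewrite bin1 mul2n /N => <-.
by case: #|I| => [//|k] /=; rewrite mulnS.
Qed.

Lemma tree4_swapK : involutive tree4_swap.
Proof. by move=> [[[[p q]|] r]|p]. Qed.

Lemma pent_swapK : involutive pent_swap.
Proof. by move=> [[p q]|]. Qed.

Lemma fdet_pent_unit : fdet pent_unit = fdet A ^+ #|I|.
Proof.
rewrite -(fdet_pairr I A) -[RHS]fdet_option; apply: eq_fdet => x y.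
by case: x => [[p q]|]; case: y => [[p' q']|].
Qed.

Lemma fdet_pent_diag G : fdet (pent_diag G) = fdet B ^+ #|I| * fdet G.
Proof.
rewrite -(fdet_pairl I B) -fdet_sum; apply: eq_fdet => x y.
by case: x => [[a r]|p]; case: y => [[b s]|q].
Qed.

Lemma fdet_pent_mid : fdet pent_mid = fdet B ^+ #|I|.
Proof.
rewrite /pent_mid (fdet_bij _ tree4_rot_bij) fdet_pent_diag.
by rewrite fdet_one mulr1.
Qed.

(** The fixed labels of [pent_swap] are [None] and the [Some (p, p)], which leaves [N]
    two-cycles. *)
Lemma pentagon_unit_fdet :
  (-1) ^+ N * fdet A ^+ #|I| * fdet A ^+ #|I| = fdet B * fdet A ^+ #|I| * fdet B.
Proof.
rewrite -fdet_pent_unit -!fdet_mul -(eq_fdet pentagon_unit) fdet_mul.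
rewrite (@fdet_involution _ _ _ _ N) 1?mulrCA ?mulrA //; first exact: pent_swapK.
rewrite (@card_fixpoints (option I) _ _ (fun x => if x is Some p then Some (p, p) else None)).
- by rewrite !card_option card_prod card_sqr addSn.
- by move=> [p|] [q|] // [->].
- by case.
- by move=> [[p q] [->]|_]; [exists (Some p) | exists None].
Qed.

(** For each [r], [tree4_swap] has [N] two-cycles exchanging [p] and [q], and one more exchanging
    [inl (None, r)] with [inr r]. *)
Lemma pentagon_simple_fdet :
  fdet B ^+ #|I| * ((-1) ^+ (#|I| * N.+1) * fdet B ^+ #|I|)
  = fdet B ^+ #|I| * fdet A * fdet B ^+ #|I| * (fdet B ^+ #|I| * fdet A).
Proof.
rewrite -fdet_pent_diag -fdet_pent_mid -!fdet_mul -(eq_fdet pentagon_simple) fdet_mul.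
rewrite (@fdet_involution _ _ _ _ (#|I| * N.+1)) //; first exact: tree4_swapK.
rewrite (@card_fixpoints (I * I)%type _ _ (fun x => inl (Some (x.1, x.1), x.2))).
- rewrite card_sum !card_prod card_option card_prod card_sqr.
  rewrite mulnS mulSn mulnDl card_sqr -!addnn. lia.
- by move=> [p q] [p' q'] /= [-> _ ->].
- by case.
- by move=> [[[[p q]|] r]|p] //= [->]; exists (p, r).
Qed.

(** * Two families of entries of the pentagon to [m] *)

Lemma tree4_sum (F : tree4 -> R) : \sum_y F y =
  \sum_p \sum_q \sum_r F (inl (Some (p, q), r)) + \sum_r F (inl (None, r)) + \sum_p F (inr p).
Proof.
rewrite big_sumType /=; congr (_ + _).
transitivity (\sum_a \sum_r F (inl (a, r))).
  by rewrite pair_bigA; apply: eq_bigr => -[].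
rewrite (bigD1 None) //= addrC; congr (_ + _).
rewrite (reindex_omap (Some : I * I -> _) id) /=; last by case.
by rewrite pair_bigA; apply: eq_big => -[p q]; rewrite ?eqxx.
Qed.

(** [V] and [U] are the column and the row of [B] at [None], without the corner [a], read as square
    matrices over [I]. *)
Let a := B None None.
Let V p t := B (Some (p, t)) None.
Let U q t := B None (Some (q, t)).

Lemma pent_diagA_mid p z :
  fmul (pent_diag A) pent_mid (inr p) z = \sum_p' A p p' * pent_mid (inr p') z.
Proof.
rewrite /fmul tree4_sum /= [X in X + _]addrC.
rewrite [X in X + _ + _]big1 ?add0r => [|r _]; last exact: mul0r.
rewrite [X in X + _]big1 ?add0r // => p' _.
by rewrite big1 // => q _; rewrite big1 // => r _; rewrite mul0r.
Qed.

(** Compare entries at [inr p], [inr q]. On the left only the intermediate labels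
    [inl (Some (p, q), r)] survive; on the right [pent_mid] restricted to [inr] labels is the scalar
    [a]. *)
Lemma pentagon_simple_rr p q : fmul V (fun t q => U q t) p q = a * fmul A A p q.
Proof.
have := pentagon_simple (inr p) (inr q).
rewrite {1}/fmul tree4_sum /pent_mid /=.
rewrite [X in _ + X]big1 ?addr0 => [|p' _]; last exact: mulr0.
rewrite [X in _ + X]big1 ?addr0 => [|p' _]; last exact: mul0r.
rewrite (bigD1 p) //= [X in _ + X]big1 ?addr0 => [|p' /negPf p'p]; last first.
  by rewrite big1 // => ? _; rewrite big1 // => ? _; rewrite eq_sym p'p !mul0r.
rewrite (bigD1 q) //= [X in _ + X]big1 ?addr0 => [|q' /negPf q'q]; last first.
  by rewrite big1 // => ? _; rewrite q'q mul0r mulr0.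
rewrite !eqxx => E.
transitivity (\sum_r 1%:R * B None (Some (q, r)) * (1%:R * B (Some (p, r)) None)).
  by apply: eq_bigr => r _; rewrite !mul1r mulrC.
rewrite {}E {1}/fmul tree4_sum /=.
rewrite [X in X + _]addrC [X in X + _ + _]big1 ?add0r => [|r _]; last exact: mulr0.
rewrite [X in X + _]big1 ?add0r => [|p' _]; last first.
  by rewrite big1 // => ? _; rewrite big1 // => ? _; rewrite mulr0.
rewrite /fmul mulr_sumr; apply: eq_bigr => q' _.
rewrite mulrA; congr (_ * _).
rewrite -/(fmul (pent_diag A) pent_mid (inr p) (inr q')) pent_diagA_mid.
rewrite (bigD1 q') //= big1 ?addr0 => [|p' /negPf p'q']; rewrite /pent_mid /=.
  by rewrite eqxx mul1r mulrC.
by rewrite p'q' mul0r mulr0.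
Qed.

(** Compare entries at [inr p], [inl (None, q)]. On the left only the intermediate label [inr q]
    survives, since [pent_mid] sends [inl (None, q)] to itself alone. *)
Lemma pentagon_simple_rl p q : fmul (fmul A V) U p q = a *+ (p == q).
Proof.
have := pentagon_simple (inr p) (inl (None, q)).
rewrite {1}/fmul tree4_sum /pent_mid /=.
rewrite [X in X + _]addrC [X in _ + X + _]big1 ?addr0 => [|p' _]; last first.
  by rewrite big1 // => ? _; rewrite big1 // => ? _; rewrite mulr0.
rewrite [X in X + _]big1 ?add0r => [|r _]; last exact: mul0r.
rewrite (bigD1 q) //= [X in _ + X]big1 ?addr0 => [|q' /negPf q'q]; last first.
  by rewrite q'q mulr0.
rewrite eqxx mulr1 => E; transitivity ((p == q)%:R * a); last by rewrite mulr_natl.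
rewrite {}E; symmetry; rewrite {1}/fmul tree4_sum /=.
rewrite [X in _ + X]big1 ?addr0 => [|r _]; last exact: mulr0.
rewrite [X in _ + X]big1 ?addr0 => [|r _]; last first.
  rewrite -/(fmul (pent_diag A) pent_mid (inr p) (inl (None, r))) pent_diagA_mid.
  by rewrite big1 ?mul0r // => p' _; rewrite mulr0.
rewrite [RHS]/fmul.
transitivity (\sum_t \sum_s fmul (pent_diag A) pent_mid (inr p) (inl (Some (s, t), q)) * V s t).
  rewrite exchange_big; apply: eq_bigr => t _; apply: eq_bigr => s _.
  rewrite (bigD1 q) //= [X in _ + X]big1 ?addr0 => [|q' /negPf q'q].
    by rewrite eqxx mul1r.
  by rewrite q'q mul0r mulr0.
apply: eq_bigr => t _; rewrite mulr_suml; apply: eq_bigr => s _.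
rewrite pent_diagA_mid (bigD1 s) //= big1 ?addr0 => [|p' /negPf p's]; rewrite /pent_mid /=.
  by rewrite eqxx mul1r mulrAC.
by rewrite p's mul0r mulr0.
Qed.

(* The two preceding lemmas say [V U^T = a A^2] and [A V U = a]. *)
Lemma fdet_cube : a != 0 -> fdet A ^+ 3 = 1.
Proof.
move=> a0; have e0 : fdet (fun x y : I => a *+ (x == y)) != 0 by rewrite fdet_scalar expf_neq0.
have := eq_fdet pentagon_simple_rl; rewrite !fdet_mul => AVU.
have VU : fdet V * fdet U = fdet (fun x y : I => a *+ (x == y)) * (fdet A * fdet A).
  rewrite -(fdet_tr U) -!fdet_mul; apply: eq_fdet => p q.
  rewrite pentagon_simple_rr [RHS](bigD1 p) //= big1 ?addr0 ?eqxx // => i /negPf.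
  by rewrite eq_sym => ->; rewrite mul0r.
apply: (mulfI e0); rewrite mulr1 -{2}AVU -mulrA VU.
by rewrite !exprS expr0 mulr1 mulrCA.
Qed.

Lemma pentagon_matrices_absurd :
  (2%N \notin [pchar R]) -> a != 0 -> (#|I| %% 4 = 2 \/ #|I| %% 4 = 3)%N -> False.
Proof.
move=> R2 /fdet_cube A3 k4.
have two0 : (-1 : R) != 1.
  apply: contra R2 => /eqP R2; rewrite inE /= -[1]/(1%:R) mulr2n -{1}R2.
  by rewrite addNr.
(* In both cases [k * (k - 1)], which is twice [N], is 2 modulo 4. *)
have N_odd : odd N.
  by have := card_sqr; rewrite /N; move: 'C(_, _) => M; case: k4; nia.
have A0 : fdet A != 0.
  by apply: contra_eq_neq A3 => ->; rewrite expr0n /= eq_sym oner_neq0.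
have B2 : fdet B ^+ 2 = - fdet A ^+ #|I|.
  have := pentagon_unit_fdet; rewrite -signr_odd N_odd expr1 mulN1r.
  by move=> E; apply: (mulIf (expf_neq0 #|I| A0)); rewrite E; ring.
have B0 : fdet B != 0.
  by rewrite -sqrf_eq0 B2 oppr_eq0 expf_neq0.
have BA : fdet B ^+ #|I| * fdet A ^+ 2 = 1.
  (* The sign disappears because [N.+1] is even. *)
  have := pentagon_simple_fdet; rewrite -signr_odd oddM /= N_odd andbF mul1r.
  set b := fdet B ^+ _; have b0 : b != 0 by rewrite expf_neq0.
  by move=> E; apply: (mulfI b0); apply: (mulfI b0); rewrite mulr1 E; ring.
have g2 : (fdet B ^+ 3) ^+ 2 = -1.
  by rewrite exprAC B2 exprNn -exprM mulnC exprM A3 expr1n mulr1 -signr_odd.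
have gk : (fdet B ^+ 3) ^+ #|I| = 1.
  rewrite exprAC -[RHS](expr1n _ 3) -BA exprMn [(fdet A ^+ 2) ^+ 3]exprAC.
  by rewrite A3 expr1n mulr1.
have g4 : (fdet B ^+ 3) ^+ 4 = 1 by rewrite (exprM _ 2 2) g2 sqrrN expr1n.
(* Put [g = fdet B ^+ 3], so that the exponent of [g] counts modulo 4. Residue 2 gives [g ^+ 2 = 1];
   residue 3 gives [g ^+ 3 = 1], whence [g = -1] and again [g ^+ 2 = 1]. Both contradict
   [g ^+ 2 = -1]. *)
move: gk; rewrite -(expr_mod _ g4); case: k4 => -> E.
  by move: two0; rewrite -g2 E eqxx.
have g1 : fdet B ^+ 3 = -1 by rewrite -E [_ ^+ 3 in RHS]exprS g2 mulrN1 opprK.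
by move: two0; rewrite -g2 g1 sqrrN expr1n eqxx.
Qed.

End PentagonMatrices.

(** * Rigid monoidal categories *)

Local Notation "g \c f" := (Defs.comp g f) (at level 38, right associativity).
Local Notation "f \t g" := (tensm f g) (at level 35, right associativity).

Section RigidMonoidal.
Variables (R : fieldType) (C : rigid_monoidal_cat R).
Implicit Types a b c d : Obj C.

Local Notation E := (Defs.unit C).

Lemma comp_is_linearr a b c (f : Hom C b c) : linear (fun g : Hom C a b => f \c g).
Proof. by move=> r g1 g2; rewrite comp_linr. Qed.
Lemma comp_is_linearl a b c (g : Hom C a b) : linear (fun f : Hom C b c => f \c g).
Proof. by move=> r f1 f2; rewrite comp_linl. Qed.
Lemma tensm_is_linearr a b c d (f : Hom C a b) : linear (fun g : Hom C c d => f \t g).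
Proof. by move=> r g1 g2; rewrite tensm_linr. Qed.
Lemma tensm_is_linearl a b c d (g : Hom C c d) : linear (fun f : Hom C a b => f \t g).
Proof. by move=> r f1 f2; rewrite tensm_linl. Qed.


Section Linear.
Variables (U V : lmodType R) (f : U -> V).
Hypothesis f_lin : linear f.

Lemma lin0 : f 0 = 0.
Proof. by apply: (addIr (f 0)); rewrite add0r -{1}[f 0]scale1r -f_lin scale1r addr0. Qed.
Lemma linZ r x : f (r *: x) = r *: f x.
Proof. by rewrite -[r *: x]addr0 f_lin lin0 addr0. Qed.
Lemma linD x y : f (x + y) = f x + f y.
Proof. by rewrite -[x]scale1r f_lin !scale1r. Qed.
Lemma lin_sum (J : finType) (F : J -> U) : f (\sum_j F j) = \sum_j f (F j).
Proof. exact: (big_morph f linD lin0). Qed.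
End Linear.

Lemma comp0r a b c (f : Hom C b c) : f \c (0 : Hom C a b) = 0.
Proof. exact: lin0 (comp_is_linearr f). Qed.
Lemma comp0l a b c (g : Hom C a b) : (0 : Hom C b c) \c g = 0.
Proof. exact: lin0 (comp_is_linearl g). Qed.
Lemma compZr a b c (f : Hom C b c) r (g : Hom C a b) : f \c (r *: g) = r *: (f \c g).
Proof. exact: linZ (comp_is_linearr f) _ _. Qed.
Lemma compZl a b c (g : Hom C a b) r (f : Hom C b c) : (r *: f) \c g = r *: (f \c g).
Proof. exact: linZ (comp_is_linearl g) _ _. Qed.
Lemma compDr a b c (f : Hom C b c) (g h : Hom C a b) : f \c (g + h) = f \c g + f \c h.
Proof. exact: linD (comp_is_linearr f) _ _. Qed.
Lemma compDl a b c (g : Hom C a b) (f h : Hom C b c) : (f + h) \c g = f \c g + h \c g.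
Proof. exact: linD (comp_is_linearl g) _ _. Qed.
Lemma comp_sumr a b c (f : Hom C b c) (J : finType) (F : J -> Hom C a b) :
  f \c (\sum_j F j) = \sum_j f \c F j.
Proof. exact: lin_sum (comp_is_linearr f) _ _. Qed.
Lemma comp_suml a b c (g : Hom C a b) (J : finType) (F : J -> Hom C b c) :
  (\sum_j F j) \c g = \sum_j F j \c g.
Proof. exact: lin_sum (comp_is_linearl g) _ _. Qed.
Lemma tensm0r a b c d (f : Hom C a b) : f \t (0 : Hom C c d) = 0.
Proof. exact: lin0 (tensm_is_linearr f). Qed.
Lemma tensm0l a b c d (f : Hom C a b) : (0 : Hom C c d) \t f = 0.
Proof. exact: lin0 (tensm_is_linearl f). Qed.
Lemma tensmZr a b c d (f : Hom C a b) r (g : Hom C c d) : f \t (r *: g) = r *: (f \t g).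
Proof. exact: linZ (tensm_is_linearr f) _ _. Qed.
Lemma tensmZl a b c d (g : Hom C c d) r (f : Hom C a b) : (r *: f) \t g = r *: (f \t g).
Proof. exact: linZ (tensm_is_linearl g) _ _. Qed.
Lemma tensmDr a b c d (f : Hom C a b) (g h : Hom C c d) : f \t (g + h) = f \t g + f \t h.
Proof. exact: linD (tensm_is_linearr f) _ _. Qed.
Lemma tensm_sumr a b c d (f : Hom C a b) (J : finType) (F : J -> Hom C c d) :
  f \t (\sum_j F j) = \sum_j f \t F j.
Proof. exact: lin_sum (tensm_is_linearr f) _ _. Qed.
Lemma tensm_suml a b c d (g : Hom C c d) (J : finType) (F : J -> Hom C a b) :
  (\sum_j F j) \t g = \sum_j F j \t g.
Proof. exact: lin_sum (tensm_is_linearl g) _ _. Qed.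

Lemma tensm_compl a b c d (f : Hom C b c) (g : Hom C a b) :
  (f \c g) \t idm d = f \t idm d \c g \t idm d.
Proof. by rewrite -tensm_comp comp1m. Qed.

Lemma tensm_compr a b c d (f : Hom C b c) (g : Hom C a b) :
  idm d \t (f \c g) = idm d \t f \c idm d \t g.
Proof. by rewrite -tensm_comp comp1m. Qed.

Lemma tensmEl a b c d (f : Hom C a b) (g : Hom C c d) : f \t g = f \t idm d \c idm a \t g.
Proof. by rewrite -tensm_comp comp1m compm1. Qed.

Lemma tensmEr a b c d (f : Hom C a b) (g : Hom C c d) : f \t g = idm b \t g \c f \t idm c.
Proof. by rewrite -tensm_comp comp1m compm1. Qed.

Lemma asc_epi a b c d (f g : Hom C (tens a (tens b c)) d) :
  f \c asc a b c = g \c asc a b c -> f = g.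
Proof. by move/(congr1 (fun h => h \c asci a b c)); rewrite -!compA asc_iso2 !compm1. Qed.

Lemma asc_mono a b c d (f g : Hom C d (tens (tens a b) c)) :
  asc a b c \c f = asc a b c \c g -> f = g.
Proof. by move/(congr1 (fun h => asci a b c \c h)); rewrite !compA asc_iso1 !comp1m. Qed.

Lemma asci_nat a1 b1 a2 b2 a3 b3 (f1 : Hom C a1 b1) (f2 : Hom C a2 b2) (f3 : Hom C a3 b3) :
  asci b1 b2 b3 \c f1 \t f2 \t f3 = (f1 \t f2) \t f3 \c asci a1 a2 a3.
Proof.
apply: (@asc_mono); apply: (@asc_epi).
by rewrite !compA asc_iso2 comp1m asc_nat -!compA asc_iso1 !compm1.
Qed.

Lemma rui_nat a1 b1 (f : Hom C a1 b1) : rui b1 \c f = f \t idm E \c rui a1.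
Proof.
rewrite -[f in LHS]compm1 -ru_iso2 [f \c _]compA -ru_nat !compA ru_iso1.
by rewrite comp1m.
Qed.

Lemma asc_tens_epi a b c d e (f g : Hom C (tens (tens a (tens b c)) e) d) :
  f \c asc a b c \t idm e = g \c asc a b c \t idm e -> f = g.
Proof.
move/(congr1 (fun h => h \c asci a b c \t idm e)).
by rewrite -!compA -tensm_compl asc_iso2 tensm_id !compm1.
Qed.

Lemma lu_faithful a b (f g : Hom C a b) : idm E \t f = idm E \t g -> f = g.
Proof.
move/(congr1 (fun h => lu b \c h)); rewrite !lu_nat.
by move/(congr1 (fun h => h \c lui a)); rewrite -!compA lu_iso2 !compm1.
Qed.

Lemma ru_faithful a b (f g : Hom C a b) : f \t idm E = g \t idm E -> f = g.
Proof.
move/(congr1 (fun h => ru b \c h)); rewrite !ru_nat.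
by move/(congr1 (fun h => h \c rui a)); rewrite -!compA ru_iso2 !compm1.
Qed.

(** Kelly's argument: after tensoring with the unit on the left, the pentagon on [(E, E, a, b)] and
    the triangle axiom identify the two sides. *)
Lemma lu_tens a b : lu (tens a b) \c asc E a b = lu a \t idm b.
Proof.
apply: lu_faithful; rewrite tensm_compr.
apply: (@asc_epi); apply: (@asc_tens_epi E E a).
rewrite -!compA -pentagon compA triangle -tensm_id -asc_nat -triangle.
by rewrite compA -asc_nat -compA -tensm_compl.
Qed.

(** Mirror image of [lu_tens], from the pentagon on [(a, b, E, E)]. *)
Lemma ru_tens a b : ru (tens a b) = idm a \t ru b \c asc a b E.
Proof.
apply: ru_faithful; apply: (@asc_mono).
rewrite -triangle compA -tensm_id asc_nat -compA pentagon.
rewrite compA -tensm_compr triangle tensm_compl !compA; congr (_ \c _).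
by rewrite asc_nat.
Qed.

(** Naturality of [lu] at [lu E] gives [lu (tens E E) = idm E \t lu E]; then [lu_tens] and the
    triangle axiom compare [lu E] and [ru E] after tensoring with [E]. *)
Lemma lu_ru_unit : lu E = ru E.
Proof.
apply: ru_faithful; rewrite -lu_tens -triangle; congr (_ \c _).
have := lu_nat (lu E); move/(congr1 (fun h => lui E \c h)).
by rewrite !compA lu_iso1 !comp1m.
Qed.

End RigidMonoidal.

(** * Fusion trees *)

Section FusionTrees.
Variables (R : fieldType) (C : rigid_monoidal_cat R).
Local Notation E := (Defs.unit C).

Variables (m : Obj C) (I : finType).
Variables (b : Hom C (tens m m) E) (c : Hom C E (tens m m)).
Variables (psi : I -> Hom C (tens m m) m) (phi : I -> Hom C m (tens m m)).

Hypothesis idmE_neq0 : idm E != 0.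
Hypothesis idm_neq0 : idm m != 0.
Hypothesis homEm0 : forall f : Hom C E m, f = 0.
Hypothesis hommE0 : forall f : Hom C m E, f = 0.
Hypothesis endm_scalar : forall f : Hom C m m, exists r, f = r *: idm m.
Hypothesis bc : b \c c = idm E.
Hypothesis psi_phi : forall i j, psi i \c phi j = (i == j)%:R *: idm m.
Hypothesis fusion_sum : c \c b + \sum_i phi i \c psi i = idm (tens m m).

Local Notation "'m1'" := (idm m).

(** Fusion trees for the two bracketings of three factors: [Some (p, q)] passes through an
    intermediate [m], [None] through an intermediate unit. The suffix [0] below marks trees ending
    in the unit. *)
Definition treeL (x : option (I * I)) : Hom C (tens (tens m m) m) m :=
  if x is Some (p, q) then psi q \c psi p \t m1 else lu m \c b \t m1.
Definition treeR (x : option (I * I)) : Hom C (tens m (tens m m)) m :=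
  if x is Some (p, q) then psi q \c m1 \t psi p else ru m \c m1 \t b.
Definition treeL0 p : Hom C (tens (tens m m) m) E := b \c psi p \t m1.
Definition treeR0 p : Hom C (tens m (tens m m)) E := b \c m1 \t psi p.

Hypothesis endE_scalar : forall f : Hom C E E, exists r, f = r *: idm E.

Lemma hom_tens_unit (f : Hom C (tens m m) E) : exists r, f = r *: b.
Proof.
have [r fc] := endE_scalar (f \c c); exists r.
rewrite -[LHS]compm1 -fusion_sum compDr comp_sumr big1 ?addr0 => [|i _].
  by rewrite compA fc compZl comp1m.
by rewrite compA [f \c _]hommE0 comp0l.
Qed.

Lemma hom_unit_tens (f : Hom C E (tens m m)) : exists r, f = r *: c.
Proof.
have [r fc] := endE_scalar (b \c f); exists r.
rewrite -[LHS]comp1m -fusion_sum compDl comp_suml big1 ?addr0 => [|i _].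
  by rewrite -compA fc compZr compm1.
by rewrite -compA [psi i \c _]homEm0 comp0r.
Qed.

Lemma hom_tens_simple (f : Hom C (tens m m) m) : exists k, f = \sum_i k i *: psi i.
Proof.
have [k fk] := fin_all_exists (fun i => endm_scalar (f \c phi i)); exists k.
rewrite -[LHS]compm1 -fusion_sum compDr comp_sumr compA [f \c c]homEm0 comp0l add0r.
by apply: eq_bigr => i _; rewrite compA fk compZl comp1m.
Qed.

Lemma tens_fusion_sum :
  m1 \t c \c m1 \t b + \sum_i m1 \t phi i \c m1 \t psi i = idm (tens m (tens m m)).
Proof.
rewrite -tensm_id -fusion_sum tensmDr tensm_sumr tensm_compr; congr (_ + _).
by apply: eq_bigr => i _; rewrite tensm_compr.
Qed.

(** Split the inner [tens m m] by [tens_fusion_sum]: on the unit summand [f] is a scalar up to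
    [ru m], on each copy of [m] it is a combination of the [psi]. *)
Lemma treeR_span (f : Hom C (tens m (tens m m)) m) : exists k, f = \sum_y k y *: treeR y.
Proof.
have [r fr] := endm_scalar (f \c m1 \t c \c rui m).
have [k fk] := fin_all_exists (fun i => hom_tens_simple (f \c m1 \t phi i)).
exists (fun y => if y is Some (p, q) then k p q else r).
rewrite -[LHS]compm1 -tens_fusion_sum compDr comp_sumr.
rewrite (bigD1 None) //= (reindex_omap (Some : I * I -> _) id) /=; last by case.
congr (_ + _).
  have frc : f \c m1 \t c = r *: ru m.
    by rewrite -[LHS]compm1 -ru_iso1 compA -[_ \c rui m]compA fr compZl comp1m.
  by rewrite compA frc compZl.
transitivity (\sum_p \sum_q k p q *: treeR (Some (p, q))); last first.
  by rewrite pair_bigA; apply: eq_big => -[p q]; rewrite ?eqxx.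
apply: eq_bigr => p _; rewrite compA fk comp_suml.
by apply: eq_bigr => q _; rewrite compZl.
Qed.

Lemma treeR0_span (f : Hom C (tens m (tens m m)) E) : exists k, f = \sum_p k p *: treeR0 p.
Proof.
have [k fk] := fin_all_exists (fun i => hom_tens_unit (f \c m1 \t phi i)); exists k.
rewrite -[LHS]compm1 -tens_fusion_sum compDr comp_sumr compA.
have -> : f \c m1 \t c = 0.
  rewrite -[LHS]compm1 -ru_iso1 compA.
  by rewrite [(f \c _) \c _]hommE0 comp0l.
rewrite comp0l add0r; apply: eq_bigr => p _.
by rewrite compA fk compZl.
Qed.

Lemma associator_matrices : exists (A : I -> I -> R) (B : option (I * I) -> option (I * I) -> R),
  (forall x, treeL x = \sum_y B x y *: treeR y \c asc m m m) /\
  (forall p, treeL0 p = \sum_q A p q *: treeR0 q \c asc m m m).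
Proof.
have [B HB] := fin_all_exists (fun x => treeR_span (treeL x \c asci m m m)).
have [A HA] := fin_all_exists (fun p => treeR0_span (treeL0 p \c asci m m m)).
exists A, B; split=> x.
  rewrite -[LHS]compm1 -asc_iso1 compA HB comp_suml.
  by apply: eq_bigr => y _; rewrite compZl.
rewrite -[LHS]compm1 -asc_iso1 compA HA comp_suml.
by apply: eq_bigr => y _; rewrite compZl.
Qed.

Variables (A : I -> I -> R) (B : option (I * I) -> option (I * I) -> R).
Hypothesis treeL_expand : forall x, treeL x = \sum_y B x y *: treeR y \c asc m m m.
Hypothesis treeL0_expand : forall p, treeL0 p = \sum_q A p q *: treeR0 q \c asc m m m.

(** This and the next two lemmas let an intermediate unit pass through an associator with
    coefficient 1; they produce the entries 1 of [pent_unit] and [pent_mid]. *)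
Lemma tens_treeR_None : treeR None \t m1 = m1 \t treeL None \c asc m (tens m m) m.
Proof.
by rewrite tensm_compl -triangle -compA asc_nat compA -tensm_compr.
Qed.

Lemma tens_treeL_None :
  treeL None \t m1 = lu (tens m m) \c b \t idm (tens m m) \c asc (tens m m) m m.
Proof.
by rewrite tensm_compl -lu_tens -compA asc_nat tensm_id.
Qed.

Lemma ru_tens_treeR_None :
  ru (tens m m) \c idm (tens m m) \t b = m1 \t treeR None \c asc m m (tens m m).
Proof.
by rewrite ru_tens -compA -tensm_id asc_nat compA -tensm_compr.
Qed.

Section Chain.
Variables (X : finType) (a d e f : Obj C).
Variables (F G : X -> X -> R) (u : X -> Hom C a d) (v : X -> Hom C e d) (w : X -> Hom C f d).
Variables (g : Hom C a e) (h : Hom C e f).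
Hypotheses (uv : forall x, u x = \sum_y F x y *: v y \c g)
  (vw : forall x, v x = \sum_y G x y *: w y \c h).

(** Along a path of associators the expansion matrices multiply, so each side of a pentagon becomes
    one matrix product. *)
Lemma expand_comp x : u x = \sum_z fmul F G x z *: w z \c (h \c g).
Proof.
rewrite uv; under eq_bigr do rewrite vw comp_suml scaler_sumr.
rewrite exchange_big; apply: eq_bigr => z _; rewrite /fmul scaler_suml.
by apply: eq_bigr => y _; rewrite compZl scalerA compA.
Qed.
End Chain.

Lemma coef_unique (X : finType) (a d : Obj C) (w : X -> Hom C a d) (w' : X -> Hom C d a)
    (f g : X -> R) :
  idm d != 0 -> (forall x y, w x \c w' y = (x == y)%:R *: idm d) ->
  \sum_x f x *: w x = \sum_x g x *: w x -> f =1 g.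
Proof.
move=> d0 ww' fg y.
have coef (k : X -> R) : (\sum_x k x *: w x) \c w' y = k y *: idm d.
  rewrite comp_suml -[RHS](sum_delta y (fun x => k x *: idm d)).
  apply: eq_bigr => x _; rewrite compZl ww' !scalerA mulrC eq_sym //.
have: (f y - g y) *: idm d = 0 by rewrite scalerBl -!coef fg subrr.
by move/eqP; rewrite scaler_eq0 (negPf d0) orbF subr_eq0 => /eqP.
Qed.

Definition treeR_dual (x : option (I * I)) : Hom C m (tens m (tens m m)) :=
  if x is Some (p, q) then m1 \t phi p \c phi q else m1 \t c \c rui m.
Definition treeR0_dual p : Hom C E (tens m (tens m m)) := m1 \t phi p \c c.

Lemma treeRK x y : treeR x \c treeR_dual y = (x == y)%:R *: m1.
Proof.
have b_phi i : b \c phi i = 0 by exact: hommE0.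
have psi_c i : psi i \c c = 0 by exact: homEm0.
case: x y => [[p q]|] [[p' q']|] /=; rewrite -!compA.
- rewrite [m1 \t _ \c _]compA -tensm_compr psi_phi tensmZr tensm_id compZl comp1m compZr.
  by rewrite psi_phi scalerA -natrM mulnb.
- by rewrite [m1 \t _ \c _]compA -tensm_compr psi_c tensm0r comp0l comp0r scale0r.
- by rewrite [m1 \t _ \c _]compA -tensm_compr b_phi tensm0r comp0l comp0r scale0r.
- by rewrite [m1 \t _ \c _]compA -tensm_compr bc tensm_id comp1m ru_iso2 scale1r.
Qed.

Lemma treeR0K p q : treeR0 p \c treeR0_dual q = (p == q)%:R *: idm E.
Proof.
rewrite -compA [m1 \t _ \c _]compA -tensm_compr psi_phi tensmZr tensm_id compZl comp1m.
by rewrite compZr bc.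
Qed.

(** The right side is the composite of [zigzag2] with [b] and [c] in place of [ev] and [coev]; this
    is how rigidity reaches [B]. *)
Lemma associator_unit_entry :
  B None None *: m1 = lu m \c b \t m1 \c asci m m m \c m1 \t c \c rui m.
Proof.
have -> : lu m \c b \t m1 \c asci m m m \c m1 \t c \c rui m
    = treeL None \c asci m m m \c treeR_dual None by rewrite /= !compA.
rewrite treeL_expand comp_suml -(sum_delta None (fun y => B None y *: m1)).
apply: eq_bigr => y _; rewrite compZl -compA [asc _ _ _ \c _]compA asc_iso2 comp1m treeRK.
by rewrite !scalerA mulrC eq_sym.
Qed.

(** Conjugate [zigzag2] by [g] and [h]. Sliding them inwards turns [ev m] into [r *: b] and [coev m]
    into [s *: c], since these hom-spaces are lines, so [r * s * B None None] is 1. *)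
Lemma associator_unit_entry_neq0 (g : Hom C m (dual m)) (h : Hom C (dual m) m) :
  h \c g = m1 -> B None None != 0.
Proof.
move=> hg.
have [r er] := hom_tens_unit (ev m \c g \t m1).
have [s es] := hom_unit_tens (m1 \t h \c coev m).
have : (r * s * B None None) *: m1 = m1.
  rewrite -[RHS]hg -[g]comp1m -zigzag2 -scalerA associator_unit_entry.
  rewrite -!compA rui_nat [_ \t coev m \c _]compA -tensmEr [h \c _]compA -lu_nat.
  rewrite -!compA [_ \t h \c _]compA -tensmEr [ev m \t h]tensmEl.
  rewrite -!compA [_ \t h \c _]compA -tensm_id -asci_nat -!compA.
  rewrite [_ \t (_ \t h) \c _]compA -tensm_comp comp1m es tensmZr compZl !compZr.
  rewrite [g \t c]tensmEl -!compA [asci (dual m) _ _ \c _]compA -tensm_id asci_nat -!compA.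
  rewrite [ev m \t _ \c _]compA -tensm_compl er tensmZl compZl compZr scalerA.
  by rewrite mulrC.
move=> rsB; apply: contra_neq idm_neq0 => B0.
by rewrite -rsB B0 mulr0 scale0r.
Qed.

(** * The pentagon on morphisms to the unit *)

Section UnitPentagon.

(** [G1], [G2], [G3], [G4] and [N] are trees on the five vertices of the pentagon; [N] belongs to
    [(m m)(m m)]. *)
Let G1 x := b \c treeL x \t m1.
Let G2 x := b \c treeR x \t m1.
Let G3 x := b \c m1 \t treeL x.
Let G4 x := b \c m1 \t treeR x.
Let N (x : option (I * I)) :=
  if x is Some (p, q) then b \c psi p \t psi q else lu E \c b \t b.

Lemma pentagon_unit_eq : 
  fmul (pent_unit A) (fun x y => pent_unit A (pent_swap x) y)
  =2 fmul (fmul B (pent_unit A)) B.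
Proof.
have s1 x : G1 x = \sum_y B x y *: G2 y \c asc m m m \t m1.
  rewrite /G1 treeL_expand tensm_suml comp_sumr; apply: eq_bigr => y _.
  by rewrite tensmZl compZr tensm_compl compA.
have s2 x : G2 x = \sum_y pent_unit A x y *: G3 y \c asc m (tens m m) m.
  rewrite pent_unit_sum; case: x => [[p q]|]; last by rewrite /G2 tens_treeR_None compA.
  rewrite /G2 tensm_compl compA -/(treeL0 q) treeL0_expand comp_suml.
  apply: eq_bigr => q' _; rewrite compZl -compA asc_nat compA -compA.
  by rewrite /G3 /treeR0 /= tensm_compr !compA.
have s3 x : G3 x = \sum_y B x y *: G4 y \c m1 \t asc m m m.
  rewrite /G3 treeL_expand tensm_sumr comp_sumr; apply: eq_bigr => y _.
  by rewrite tensmZr compZr tensm_compr compA.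
have s4 x : G1 x = \sum_y pent_unit A x y *: N y \c asc (tens m m) m m.
  rewrite pent_unit_sum; case: x => [[p q]|].
    rewrite /G1 tensm_compl compA -/(treeL0 q) treeL0_expand comp_suml.
    apply: eq_bigr => q' _; rewrite compZl -compA asc_nat compA tensm_id.
    by rewrite /treeR0 -!compA [m1 \t _ \c _]compA -tensmEr.
  rewrite /G1 tens_treeL_None /N /= !compA -lu_nat -!compA.
  by rewrite [_ \t b \c _]compA -tensmEr.
(* Now [psi q] is carried along and [A] acts on [p], so [q] becomes the inner label of [G4]: this is
   the source of [pent_swap]. *)
have s5 x : N x = \sum_y pent_unit A (pent_swap x) y *: G4 y \c asc m m (tens m m).
  rewrite pent_unit_sum; case: x => [[p q]|] /=.
    rewrite tensmEl compA -/(treeL0 p) treeL0_expand comp_suml.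
    apply: eq_bigr => q' _; rewrite compZl -tensm_id -compA asc_nat compA.
    by rewrite /G4 /treeR0 /= tensm_compr !compA.
  (* With both halves mapped to the unit, one path ends in [lu E] and the other in [ru E]. *)
  rewrite /G4 -compA -ru_tens_treeR_None lu_ru_unit compA -ru_nat -compA.
  by rewrite -tensmEl.
have E2 x := expand_comp s4 s5 x; have E1 x := expand_comp (expand_comp s1 s2) s3 x.
move=> x; apply: (coef_unique (w := G4) (w' := fun y => m1 \t treeR_dual y \c c)) => //.
  move=> y z; rewrite -compA [m1 \t _ \c _]compA -tensm_compr treeRK.
  by rewrite tensmZr compZl compZr tensm_id comp1m bc.
(* Compose with the two associators of the short side, so that the pentagon axiom applies. *)
apply: (@asc_epi); apply: (@asc_epi).
rewrite !comp_suml; under eq_bigr do rewrite !compZl -compA.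
rewrite -E2 E1; apply: eq_bigr => y _.
by rewrite !compZl -!compA pentagon.
Qed.
End UnitPentagon.

(** * The pentagon on morphisms to [m] *)

Section SimplePentagon.

Let H1 (x : tree4 I) : Hom C (tens (tens (tens m m) m) m) m :=
  match x with
  | inl (a, r) => psi r \c treeL a \t m1 | inr p => lu m \c treeL0 p \t m1 end.
Let H2 (x : tree4 I) : Hom C (tens (tens m (tens m m)) m) m :=
  match x with
  | inl (a, r) => psi r \c treeR a \t m1 | inr p => lu m \c treeR0 p \t m1 end.
Let H3 (x : tree4 I) : Hom C (tens m (tens (tens m m) m)) m :=
  match x with
  | inl (a, r) => psi r \c m1 \t treeL a | inr p => ru m \c m1 \t treeL0 p end.
Let H4 (x : tree4 I) : Hom C (tens m (tens m (tens m m))) m :=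
  match x with
  | inl (a, r) => psi r \c m1 \t treeR a | inr p => ru m \c m1 \t treeR0 p end.
Let K (x : tree4 I) : Hom C (tens (tens m m) (tens m m)) m :=
  match x with
  | inl (Some (p, q), r) => psi r \c psi p \t psi q
  | inl (None, q) => lu m \c b \t psi q
  | inr p => ru m \c psi p \t b
  end.
Let H4_dual (x : tree4 I) : Hom C m (tens m (tens m (tens m m))) :=
  match x with
  | inl (a, r) => m1 \t treeR_dual a \c phi r
  | inr p => m1 \t treeR0_dual p \c rui m end.

Lemma H4K x y : H4 x \c H4_dual y = (x == y)%:R *: m1.
Proof.
case: x y => [[a r]|p] [[a' r']|p'] /=; rewrite -!compA [m1 \t _ \c _]compA -tensm_compr.
- rewrite treeRK tensmZr tensm_id compZl comp1m compZr.
  by rewrite psi_phi scalerA -natrM mulnb.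
- by rewrite [treeR a \c _]homEm0 tensm0r comp0l comp0r scale0r.
- by rewrite [treeR0 p \c _]hommE0 tensm0r comp0l comp0r scale0r.
- by rewrite treeR0K tensmZr tensm_id compZl comp1m compZr ru_iso2.
Qed.

Lemma pentagon_simple_eq :
  fmul (pent_mid B) (fun x y => pent_mid B (tree4_swap x) y)
  =2 fmul (fmul (pent_diag B A) (pent_mid B)) (pent_diag B A).
Proof.
have t1 x : H1 x = \sum_y pent_diag B A x y *: H2 y \c asc m m m \t m1.
  rewrite pent_diag_sum; case: x => [[a r]|p] /=.
    rewrite treeL_expand tensm_suml comp_sumr; apply: eq_bigr => y _.
    by rewrite tensmZl compZr tensm_compl compA.
  rewrite treeL0_expand tensm_suml comp_sumr; apply: eq_bigr => y _.
  by rewrite tensmZl compZr tensm_compl compA.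
have t3 x : H3 x = \sum_y pent_diag B A x y *: H4 y \c m1 \t asc m m m.
  rewrite pent_diag_sum; case: x => [[a r]|p] /=.
    rewrite treeL_expand tensm_sumr comp_sumr; apply: eq_bigr => y _.
    by rewrite tensmZr compZr tensm_compr compA.
  rewrite treeL0_expand tensm_sumr comp_sumr; apply: eq_bigr => y _.
  by rewrite tensmZr compZr tensm_compr compA.
have t2 x : H2 x = \sum_y pent_mid B x y *: H3 y \c asc m (tens m m) m.
  (* From here [x] is the rotated label. Its last component [s] is the inner vertex [psi s], past
     which the associator moves by naturality; what remains is [treeL a]. *)
  rewrite -[x]tree4_rotK; move: (tree4_rot x) => {x} x; rewrite pent_mid_sum.
  case: x => [[a s]|r]; last by rewrite /H2 /= tens_treeR_None compA.
  transitivity (treeL a \c (m1 \t psi s) \t m1).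
    by case: a => [[q r]|] /=; rewrite tensm_compl compA.
  rewrite treeL_expand comp_suml; apply: eq_bigr => y _.
  rewrite compZl -compA asc_nat compA; congr (_ *: (_ \c _)).
  by case: y => [[q r]|] /=; rewrite tensm_compr compA.
have t4 x : H1 x = \sum_y pent_mid B x y *: K y \c asc (tens m m) m m.
  rewrite -[x]tree4_rotK; move: (tree4_rot x) => {x} x; rewrite pent_mid_sum.
  case: x => [[a s]|r]; last first.
    rewrite /H1 /= tens_treeL_None /K /= !compA -lu_nat -!compA.
    by rewrite [_ \t psi r \c _]compA -tensmEr.
  transitivity (treeL a \c (psi s \t m1) \t m1).
    by case: a => [[q r]|] /=; rewrite tensm_compl compA.
  rewrite treeL_expand comp_suml; apply: eq_bigr => y _.
  rewrite compZl -compA asc_nat compA tensm_id; congr (_ *: (_ \c _)).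
  by case: y => [[q r]|] /=; rewrite -compA -tensmEr.
(* The vertex carried along is now the right half of [(m m)(m m)], whereas [K] lists the left half
   first; the swap makes the rotated label fit. *)
have t5' x : K (tree4_swap x) = \sum_y pent_mid B x y *: H4 y \c asc m m (tens m m).
  rewrite -[x]tree4_rotK; move: (tree4_rot x) => {x} x; rewrite pent_mid_sum.
  case: x => [[a s]|r]; last first.
    rewrite /H4 /= -compA -ru_tens_treeR_None compA -ru_nat -compA.
    by rewrite -tensmEl.
  transitivity (treeL a \c idm (tens m m) \t psi s).
    by case: a => [[q r]|] /=; rewrite -compA -tensmEl.
  rewrite treeL_expand comp_suml; apply: eq_bigr => y _.
  rewrite compZl -tensm_id -compA asc_nat compA; congr (_ *: (_ \c _)).
  by case: y => [[q r]|] /=; rewrite tensm_compr compA.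
have t5 x : K x = \sum_y pent_mid B (tree4_swap x) y *: H4 y \c asc m m (tens m m).
  by rewrite -t5' tree4_swapK.
have E2 x := expand_comp t4 t5 x; have E1 x := expand_comp (expand_comp t1 t2) t3 x.
move=> x; apply: (coef_unique (w := H4) (w' := H4_dual) idm_neq0 H4K).
apply: (@asc_epi); apply: (@asc_epi).
rewrite !comp_suml; under eq_bigr do rewrite !compZl -compA.
rewrite -E2 E1; apply: eq_bigr => y _.
by rewrite !compZl -!compA pentagon.
Qed.
End SimplePentagon.
End FusionTrees.

(** * The dual of the simple object *)

Section SimpleDual.
Variables (R : fieldType) (C : rigid_monoidal_cat R).
Local Notation E := (Defs.unit C).

Lemma hom_dim1 (a : Obj C) : hom_dim a a = 1%N ->
  idm a != 0 /\ forall f : Hom C a a, exists r, f = r *: idm a.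
Proof.
rewrite /hom_dim => dim1.
have id0 : idm a != 0.
  apply/eqP => id0; suff fv0 : (fullv : {vspace Hom C a a}) = 0%VS.
    by move: dim1; rewrite fv0 dimv0.
  apply/eqP; rewrite -subv0; apply/subvP => f _.
  by rewrite memv0 -[f]comp1m id0 comp0l.
split=> // f; apply/vlineP.
suff -> : <[idm a]>%VS = fullv by exact: memvf.
by apply/eqP; rewrite eqEdim subvf dim1 dim_vline id0.
Qed.

Lemma hom_dim0 (a d : Obj C) : hom_dim a d = 0%N -> forall f : Hom C a d, f = 0.
Proof.
move=> /eqP; rewrite /hom_dim dimv_eq0 => /eqP fv0 f.
by apply/eqP; rewrite -memv0 -fv0 memvf.
Qed.

Variable m : Obj C.
Hypothesis idmE_neq0 : idm E != 0.
Hypothesis idm_neq0 : idm m != 0.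
Hypothesis homEm0 : forall f : Hom C E m, f = 0.

(** By [zigzag2], [f] is recovered from its mate, a morphism from [E] to [tens m E], hence
    essentially one from [E] to [m]. *)
Lemma hom_dual_unit0 (f : Hom C (dual m) E) : f = 0.
Proof.
have f0 : idm m \t f \c coev m = 0.
  rewrite -[LHS]comp1m -ru_iso1 -compA [ru m \c _]homEm0; exact: comp0r.
rewrite -[f]compm1 -zigzag2 [f \c _]compA -lu_nat.
rewrite -!compA [_ \t f \c _]compA -tensmEr [ev m \t f]tensmEl.
rewrite -!compA [_ \t f \c _]compA -tensm_id -asci_nat -!compA.
rewrite [_ \t (_ \t f) \c _]compA -tensm_comp f0.
by rewrite tensm0r comp0l !comp0r.
Qed.

Variables (n : nat) (s : 'I_n -> Obj C).
Hypothesis s_simple : forall i, isomorphic (s i) E \/ isomorphic (s i) m.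
Hypothesis s_dual : is_biproduct s (dual m).

(** A summand isomorphic to the unit would give a nonzero morphism from [dual m] to [E]. *)
Lemma dual_summand i : isomorphic (s i) m.
Proof.
case: (s_simple i) => // -[u [v [vu uv]]]; case: s_dual => inj [prj [pi_id _ _]].
case/eqP: idmE_neq0; rewrite -uv -[u]compm1 -pi_id compA.
by rewrite [u \c prj i]hom_dual_unit0 !comp0l.
Qed.

Lemma hom_unit_dual0 (f : Hom C E (dual m)) : f = 0.
Proof.
case: s_dual => inj [prj [_ _ sum_id]].
rewrite -[f]comp1m -sum_id comp_suml big1 // => i _.
have [u [v [vu uv]]] := dual_summand i.
rewrite -compA -[prj i \c f]comp1m -vu -compA [u \c _]homEm0.
by rewrite !comp0r.
Qed.

(* By duality [Hom(m, 1) = Hom(1, dual m)]; the definition of a near-group category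
   only gives [Hom(1, m) = 0]. *)
Lemma hom_simple_unit0 (f : Hom C m E) : f = 0.
Proof.
have f0 : f \t idm (dual m) \c coev m = 0.
  rewrite -[LHS]comp1m -lu_iso1 -compA [lu _ \c _]hom_unit_dual0; exact: comp0r.
rewrite -[f]compm1 -zigzag1 [f \c _]compA -ru_nat.
rewrite -!compA [f \t _ \c _]compA -tensmEl [f \t ev m]tensmEr.
rewrite -!compA [f \t _ \c _]compA -tensm_id -asc_nat -!compA.
rewrite [(f \t _) \t _ \c _]compA -tensm_compl f0.
by rewrite tensm0l comp0l !comp0r.
Qed.

(** Any summand of [dual m] is a copy of [m]. There is at least one: if [n = 0] then [coev m]
    vanishes, and [zigzag1] forces [idm m = 0]. *)
Lemma dual_retract : exists (g : Hom C m (dual m)) (h : Hom C (dual m) m), h \c g = idm m.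
Proof.
case: s_dual => inj [prj [pi_id _ sum_id]].
have [n0|n_gt0] := posnP n; last first.
  have [u [v [vu uv]]] := dual_summand (Ordinal n_gt0).
  exists (inj _ \c v), (u \c prj _).
  by rewrite -compA [prj _ \c _]compA pi_id comp1m.
case/eqP: idm_neq0; rewrite -zigzag1.
have id0 : idm (dual m) = 0.
  by rewrite -sum_id big1 // => i; have := ltn_ord i; rewrite {2}n0.
have -> : coev m = 0.
  by rewrite -[coev m]comp1m -tensm_id id0 tensm0r comp0l.
by rewrite tensm0l comp0l !comp0r.
Qed.

End SimpleDual.

(** * Fusion data of a near-group category and the contradiction *)

Lemma near_group_fusion (R : fieldType) (C : rigid_monoidal_cat R) (m x : Obj C) k :
  is_biproduct (fun i : 'I_k.+1 => if i == ord0 then Defs.unit C else m) x ->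
  isomorphic (tens m m) x ->
  exists (b : Hom C (tens m m) (Defs.unit C)) (c : Hom C (Defs.unit C) (tens m m))
    (psi : 'I_k -> Hom C (tens m m) m) (phi : 'I_k -> Hom C m (tens m m)),
  [/\ b \c c = idm _,
      forall i j, psi i \c phi j = (i == j)%:R *: idm m
    & c \c b + \sum_i phi i \c psi i = idm (tens m m)].
Proof.
move=> [inj [prj [pi_id pi0 sum_id]]] [f [g [gf fg]]].
exists (prj ord0 \c f), (g \c inj ord0).
(* Index [ord0] is the unit summand; [lift ord0] enumerates the [k] copies of [m]. *)
exists (fun i => prj (lift ord0 i) \c f), (fun i => g \c inj (lift ord0 i)).
have pfgi i j : (prj i \c f) \c g \c inj j = prj i \c inj j.
  by rewrite -compA [f \c _]compA fg comp1m.
split.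
- exact: etrans (pfgi ord0 ord0) (pi_id ord0).
- move=> i j; rewrite (pfgi (lift ord0 i) (lift ord0 j)).
  have [-> | ij] := eqVneq i j; first by rewrite scale1r; exact: (pi_id (lift ord0 j)).
  by rewrite scale0r; apply: (pi0 (lift ord0 i) (lift ord0 j)); rewrite (inj_eq lift_inj).
rewrite -gf -[f in RHS]comp1m -sum_id big_ord_recl compDl compDr comp_suml comp_sumr.
by congr (_ + _); [|apply: eq_bigr => i _]; rewrite -!compA.
Qed.

Theorem theorem1p4 (R : fieldType) (k : nat) :
  (2%N \notin [pchar R])%R -> (1 <= k)%N -> (k %% 4 = 2 \/ k %% 4 = 3)%N ->
  forall C : rigid_monoidal_cat R, ~ near_group_trivial C k.
Proof.
move=> R2 _ k4 C [m [/hom_dim1[idE endE] /hom_dim1[idm0 endm] /hom_dim0 homEm0]].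
move=> decomp [x [mm_x x_mm]].
have [n [s [s_simple s_dual]]] := decomp (dual m).
have hommE0 := hom_simple_unit0 idE homEm0 s_simple s_dual.
have [g [h hg]] := dual_retract idE idm0 homEm0 s_simple s_dual.
have [b [c [psi [phi [bc psi_phi fusion_sum]]]]] := near_group_fusion mm_x x_mm.
have [A [B [HB HA]]] := associator_matrices homEm0 hommE0 endm fusion_sum endE.
apply: (@pentagon_matrices_absurd R 'I_k A B) => //.
- exact: (pentagon_unit_eq idE homEm0 hommE0 bc psi_phi HB HA).
- exact: (pentagon_simple_eq idm0 homEm0 hommE0 bc psi_phi HB HA).
- exact: (associator_unit_entry_neq0 idm0 homEm0 hommE0 bc psi_phi fusion_sum endE HB hg).
- by rewrite card_ord.
Qed.
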